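(* Let $\boldsymbol{\xi}$ be a random vector in $\mathbb{R}^d$ with joint probability density $\rho$, let $p\ge0$ be an integer, and let $\{\Psi_{\boldsymbol{\alpha}}\}_{|\boldsymbol{\alpha}|\le p}$ be the orthonormal polynomial basis functions defined in the context. Let $y(\boldsymbol{\xi})$ be any square-integrable function, let $y_p(\boldsymbol{\xi})=\sum_{|\boldsymbol{\alpha}|=0}^{p}c_{\boldsymbol{\alpha}}\Psi_{\boldsymbol{\alpha}}(\boldsymbol{\xi})$ be the projection of $y(\boldsymbol{\xi})$ onto the space $\mathcal{S}_p$ of polynomials of total degree at most $p$, and let $\mathbf{c}=[\cdots,c_{\boldsymbol{\alpha}},\cdots]\in\mathbb{R}^n$. Given samples $\boldsymbol{\xi}_1,\ldots,\boldsymbol{\xi}_m$, the matrix $\boldsymbol{\Phi}\in\mathbb{R}^{m\times n}$ of values of the $n$ basis functions at these samples, the vector $\mathbf{y}\in\mathbb{R}^m$ of simulation values $y_k=y(\boldsymbol{\xi}_k)$, and a sparsity level $s$, let $\mathbf{c}^*=[\cdots,c^*_{\boldsymbol{\alpha}},\cdots]$ be a solution of $$\min_{\mathbf{z}\in\mathbb{R}^n}\|\boldsymbol{\Phi}\mathbf{z}-\mathbf{y}\|_2\quad\text{s.t.}\quad\|\mathbf{z}\|_0\le s,$$ and let $y^*(\boldsymbol{\xi})=\sum_{|\boldsymbol{\alpha}|=0}^{p}c^*_{\boldsymbol{\alpha}}\Psi_{\boldsymbol{\alpha}}(\boldsymbol{\xi})$ be the constructed surrogate function. Then $$\|y(\b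oldsymbol{\xi})-y^*(\boldsymbol{\xi})\|_2\le\|\mathbf{c}-\mathbf{c}^*\|_2+\|y(\boldsymbol{\xi})-y_p(\boldsymbol{\xi})\|_2.$$
   Context: For a square-integrable function $y(\boldsymbol{\xi})$ (that is, $\mathbb{E}[y^2(\boldsymbol{\xi})]<\infty$, expectation with respect to $\rho$), $\|y(\boldsymbol{\xi})\|_2=\sqrt{\mathbb{E}[y^2(\boldsymbol{\xi})]}$; for vectors, $\|\cdot\|_2$ is the Euclidean norm and $\|\cdot\|_0$ the number of nonzero entries. For $\boldsymbol{\alpha}\in\mathbb{N}^d$, $|\boldsymbol{\alpha}|=\alpha_1+\cdots+\alpha_d$; the sum $\sum_{|\boldsymbol{\alpha}|=0}^{p}$ runs over all multi-indices with $|\boldsymbol{\alpha}|\le p$, of which there are $n=\binom{d+p}{d}$. The projection is the orthogonal projection in $L^2$ with respect to $\rho$. Basis functions: let $\mathbf{b}(\boldsymbol{\xi})$ be the vector of all $n$ monomials $\xi_1^{\alpha_1}\cdots\xi_d^{\alpha_d}$ with $|\boldsymbol{\alpha}|\le p$ in graded lexicographic order, let $\mathbf{M}=\mathbb{E}[\mathbf{b}(\boldsymbol{\xi})\mathbf{b}(\boldsymbol{\xi})^T]$ (moments up to order $2p$ finite, $\mathbf{M}$ positive definite), with Cholesky factorization $\mathbf{M}=\mathbf{L}\mathbf{L}^T$. The $\Psi_{\boldsymbol{\alpha}}$ are the components of $\mathbf{L}^{-1}\mathbf{b}(\boldsymbol{\xi})$ in graded lexicographic order; they satisfy $\mathbb{E}[\Psi_{\boldsymbol{\alpha}}\Psi_{\boldsymbol{\beta}}]=1$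 if $\boldsymbol{\alpha}=\boldsymbol{\beta}$ and $0$ otherwise. *)

(* Defs.v *)
From HB Require Import structures.
From mathcomp Require Import all_boot all_order all_algebra.
From mathcomp Require Import all_classical all_reals all_analysis.

Set Implicit Arguments.
Unset Strict Implicit.
Unset Printing Implicit Defensive.

Import Order.TTheory GRing.Theory Num.Theory.
Local Open Scope classical_set_scope.
Local Open Scope ring_scope.

(* Points of R^d are d-tuples, with the product (hence Borel) sigma-algebra.
   Lebesgue measure on R^d is built by recursion on d: the measure on R^(d+1)
   is the image of the product of the Lebesgue measures on R and R^d under
   (x, t) |-> x :: t, and the measure on the one-point space R^0 has mass 1. *)
Section lebesgue_tuple.
Variable R : realType.

Definition tcons d (z : measurableTypeR R * d.-tuple R) : d.+1.-tuple R :=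
  [tuple of (z.1 : R) :: z.2].

Lemma measurable_tcons d : measurable_fun setT (@tcons d).
Proof.
apply: (@measurable_cons _ _ _ R) => /=; last exact: measurable_snd.
exact: (@measurable_fst _ _ (measurableTypeR R) (d.-tuple R)).
Qed.

Section step.
Variables (d : nat) (mu : {sigma_finite_measure set (d.-tuple R) -> \bar R}).

Definition lebesgue_tupleS : set (d.+1.-tuple R) -> \bar R :=
  pushforward (@lebesgue_measure R \x mu)%E (@tcons d).

Let image_measure : {measure set (d.+1.-tuple R) -> \bar R} :=
  measure_function_pushforward__canonical__measure_function_Measure
    (@lebesgue_measure R \x mu)%E (@measurable_tcons d).

Let lebesgue_tupleS0 : lebesgue_tupleS set0 = 0%E.
Proof. exact: (measure0 image_measure). Qed.

Let lebesgue_tupleS_ge0 A : (0 <= lebesgue_tupleS A)%E.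
Proof. exact: (measure_ge0 image_measure). Qed.

Let lebesgue_tupleS_sigma_additive : semi_sigma_additive lebesgue_tupleS.
Proof. exact: (@measure_semi_sigma_additive _ _ _ image_measure). Qed.

HB.instance Definition _ := isMeasure.Build _ _ _ lebesgue_tupleS
  lebesgue_tupleS0 lebesgue_tupleS_ge0 lebesgue_tupleS_sigma_additive.

Let lebesgue_tupleS_sigma_finite : sigma_finite setT lebesgue_tupleS.
Proof.
pose u (t : d.+1.-tuple R) : measurableTypeR R * d.-tuple R :=
  (thead t, [tuple of behead t]).
have tconsK : cancel (@tcons d) u.
  by case=> x t; congr (_, _); apply: val_inj.
have mu_u : measurable_fun setT u.
  apply/measurable_fun_pairP; split; last exact: measurable_behead.
  exact: (@measurable_tnth _ R).
(* Canonical inference finds the instance for products of subprobabilities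
   instead, hence the explicit name. *)
have [F FT Ffin] := @isSigmaFinite.sigma_finiteT _ _ _ _
  (lebesgue_integral_fubini.measure_function_Measure_isSigmaFinite__to__measure_function_isSigmaFinite
    (@lebesgue_measure R) mu).
exists (fun i => u @^-1` F i).
  by rewrite -preimage_bigcup -FT preimage_setT.
move=> i; have [mF Foo] := Ffin i; split.
  by rewrite -[_ @^-1` _]setTI; exact: mu_u.
rewrite /lebesgue_tupleS /pushforward (_ : _ @^-1` _ = F i)//.
by rewrite -comp_preimage (_ : u \o _ = id)//; apply/funext => z; exact: tconsK.
Qed.

HB.instance Definition _ := Measure_isSigmaFinite.Build _ _ _ lebesgue_tupleS
  lebesgue_tupleS_sigma_finite.
End step.

Fixpoint lebesgue_tuple d : {sigma_finite_measure set (d.-tuple R) -> \bar R} :=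
  match d with
  | 0 => \d_ ([tuple] : 0.-tuple R)
  | d'.+1 => lebesgue_tupleS (lebesgue_tuple d')
  end.
End lebesgue_tuple.

(* Since |alpha| <= p forces every entry to be at most p, the multi-indices
   are encoded as tuples over 'I_p.+1. *)
Definition mdeg d p (a : d.-tuple 'I_p.+1) : nat := \sum_(i <- a) i.

(* Order of the list 1, x_1, ..., x_d, x_1^2, x_1 x_2, ..., x_d^p: by
   increasing degree, and at equal degree the lexicographically larger exponent
   first. *)
Definition grlex d p (a b : d.-tuple 'I_p.+1) : bool :=
  (mdeg a < mdeg b)%N ||
  ((mdeg a == mdeg b) && ((b : d.-tuplelexi 'I_p.+1) <= a)%O).

Definition mindex_seq d p : seq (d.-tuple 'I_p.+1) :=
  sort (@grlex d p) (enum [pred a : d.-tuple 'I_p.+1 | mdeg a <= p]%N).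

Lemma size_mindex_seq d p : size (mindex_seq d p) == 'C(d + p, d).
Proof. by rewrite size_sort -cardE -cardsE card_partial_ord_partitions. Qed.

Definition mindex d p : 'C(d + p, d).-tuple (d.-tuple 'I_p.+1) :=
  Tuple (size_mindex_seq d p).

Section definitions.
Context {R : realType}.

Definition monomial d (a : 'I_d -> nat) (x : d.-tuple R) : R :=
  \prod_(i < d) tnth x i ^+ a i.

Definition monomials d p (x : d.-tuple R) : 'cV[R]_('C(d + p, d)) :=
  \col_i monomial (fun j => tnth (tnth (mindex d p) i) j) x.

Definition poly_space d p : set (d.-tuple R -> R) :=
  [set q | exists a : 'cV[R]_('C(d + p, d)),
     forall x, q x = \sum_i a i 0 * monomials p x i 0].

Definition posdefmx n (A : 'M[R]_n) : Prop :=
  A^T = A /\ forall z : 'cV[R]_n, z != 0 -> 0 < (z^T *m A *m z) 0 0.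

(* [is_trig_mx] is lower triangularity. *)
Definition is_cholesky n (A L : 'M[R]_n) : Prop :=
  [/\ is_trig_mx L, forall i, 0 < L i i & A = L *m L^T].

(* Basis functions: the components of L^-1 b(x), b the vector of monomials and
   L the Cholesky factor of its moment matrix. *)
Definition psi d p (L : 'M[R]_('C(d + p, d))) (i : 'I_('C(d + p, d)))
    (x : d.-tuple R) : R :=
  (invmx L *m monomials p x) i 0.

Definition expansion d p (L : 'M[R]_('C(d + p, d))) (c : 'cV[R]_('C(d + p, d)))
    (x : d.-tuple R) : R :=
  \sum_i c i 0 * psi L i x.

Definition euclid_norm n (z : 'cV[R]_n) : R := Num.sqrt (\sum_i z i 0 ^+ 2).

Definition l0norm n (z : 'cV[R]_n) : nat := #|[pred i | z i 0 != 0]|.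

Definition sparse_lsq_solution m n (A : 'M[R]_(m, n)) (b : 'cV[R]_m) (s : nat)
    (z : 'cV[R]_n) : Prop :=
  (l0norm z <= s)%N /\
  forall z' : 'cV[R]_n, (l0norm z' <= s)%N ->
    euclid_norm (A *m z - b) <= euclid_norm (A *m z' - b).

Definition sample_matrix d p m (L : 'M[R]_('C(d + p, d)))
    (xs : 'I_m -> d.-tuple R) : 'M[R]_(m, 'C(d + p, d)) :=
  \matrix_(k, i) psi L i (xs k).

Section random_vector.
Context {disp : measure_display} {Omega : measurableType disp}.
Variables (P : probability Omega R) (d : nat).
Variable xi : {mfun Omega >-> d.-tuple R}.

Definition joint_density (rho : d.-tuple R -> R) : Prop :=
  [/\ measurable_fun setT rho, forall x, 0 <= rho x &
      forall A, measurable A ->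
        distribution P xi A = (\int[lebesgue_tuple R d]_(x in A) (rho x)%:E)%E].

Definition finite_moments (k : nat) : Prop :=
  forall a : 'I_d -> nat, (\sum_i a i <= k)%N ->
    P.-integrable setT (EFin \o (monomial a \o xi)).

Definition moment_matrix (p : nat) : 'M[R]_('C(d + p, d)) :=
  \matrix_(i, j)
    fine 'E_P[fun w => (monomials p (xi w) i 0 * monomials p (xi w) j 0)%R].

Definition square_integrable (f : d.-tuple R -> R) : Prop :=
  measurable_fun setT f /\ ('E_P[fun w => (f (xi w) ^+ 2)%R] < +oo)%E.

(* Valued in the extended reals: +oo when f(xi) is not square-integrable. *)
Definition L2norm (f : d.-tuple R -> R) : \bar R :=
  sqrte 'E_P[fun w => (f (xi w) ^+ 2)%R].

(* Orthogonal projection: g belongs to S and f - g is orthogonal to S. *)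
Definition L2_projection (S : set (d.-tuple R -> R)) (f g : d.-tuple R -> R) :
    Prop :=
  S g /\
  forall q, S q ->
    ('E_P[fun w => ((f (xi w) - g (xi w)) * q (xi w))%R] = 0)%E.
End random_vector.
End definitions.

(* Main.v *)
(* Write y - ystar = (y_p - ystar) + (y - y_p) and apply Minkowski's inequality. The
   first term is the expansion with coefficients e = c - cstar, that is v^T b(xi)
   with v = L^-T e, so that E[(v^T b)^2] = v^T M v = v^T L L^T v = |e|^2. *)
Require Import Defs.
From HB Require Import structures.
From mathcomp Require Import all_boot all_order all_algebra.
From mathcomp Require Import all_classical all_reals all_analysis.
From mathcomp Require Import measurable_realfun.

Set Implicit Arguments.
Unset Strict Implicit.
Unset Printing Implicit Defensive.

Import Order.TTheory GRing.Theory Num.Theory.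
Local Open Scope classical_set_scope.
Local Open Scope ring_scope.

(** Sorting keeps membership, so every entry of [mindex] still passes the degree filter in
    [mindex_seq]. *)
Lemma mdeg_mindex d p (i : 'I_('C(d + p, d))) :
  (\sum_j tnth (tnth (mindex d p) i) j <= p)%N.
Proof.
have := mem_tnth i (mindex d p).
by rewrite mem_sort mem_enum inE /mdeg big_tuple.
Qed.

Lemma monomialM (R : realType) d (a b : 'I_d -> nat) (x : d.-tuple R) :
  monomial a x * monomial b x = monomial (fun i => (a i + b i)%N) x.
Proof. by rewrite /monomial -big_split; apply: eq_bigr => i _; rewrite exprD. Qed.

Lemma measurable_monomial (R : realType) d (a : 'I_d -> nat) :
  measurable_fun setT (@monomial R d a).
Proof.
apply: measurable_prod => i _; apply: measurable_funX.
exact: measurable_tnth.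
Qed.

Lemma is_cholesky_unitmx (R : realType) n (A L : 'M[R]_n) :
  is_cholesky A L -> L \in unitmx.
Proof.
case=> Ltrig L_gt0 _; rewrite unitmxE det_trig// unitfE.
by apply/prodf_neq0 => i _; rewrite gt_eqF.
Qed.

(** Transposition moves [invmx L] from the basis to the coefficients, which reduces measurability
    and second moments to those of monomials. *)
Lemma expansionE (R : realType) d p (L : 'M[R]_('C(d + p, d)))
    (c : 'cV[R]_('C(d + p, d))) x :
  expansion L c x = \sum_i ((invmx L)^T *m c) i 0 * monomials p x i 0.
Proof.
rewrite /expansion /psi.
transitivity ((c^T *m (invmx L *m monomials p x)) 0 0).
  by rewrite mxE; apply: eq_bigr => i _; rewrite [c^T _ _]mxE.
rewrite mulmxA -[in LHS](trmxK (invmx L)) -trmx_mul mxE.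
by apply: eq_bigr => i _; rewrite mxE.
Qed.

Lemma measurable_expansion (R : realType) d p (L : 'M[R]_('C(d + p, d)))
    (c : 'cV[R]_('C(d + p, d))) : measurable_fun setT (expansion L c).
Proof.
have -> : expansion L c =
    fun x => \sum_i ((invmx L)^T *m c) i 0 * monomials p x i 0.
  by apply/funext => x; exact: expansionE.
apply: measurable_sum => i; apply: measurable_funM => //.
have -> : (fun x => monomials p x i 0) =
    @monomial R d (fun j => tnth (tnth (mindex d p) i) j).
  by apply/funext => x; rewrite mxE.
exact: measurable_monomial.
Qed.

Section second_moments.
Variables (R : realType) (disp : measure_display).
Variables (Omega : measurableType disp) (P : probability Omega R).
Variables (d p : nat) (xi : {mfun Omega >-> d.-tuple R}).

(** Bridge to the Lebesgue norm of exponent 2, for which Minkowski's inequality is available. *)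
Lemma L2normE (f : d.-tuple R -> R) :
  L2norm P xi f = ('N[P]_2%:E[EFin \o (f \o xi)])%E.
Proof.
rewrite /L2norm unlock [in RHS]unlock poweR12_sqrt; last first.
  by apply: integral_ge0 => w _; exact: poweR_ge0.
congr sqrte; apply: eq_integral => w _ /=.
by rewrite powR_mulrn// real_normK// num_real.
Qed.

Lemma ler_L2normD (f g : d.-tuple R -> R) :
  measurable_fun setT f -> measurable_fun setT g ->
  (L2norm P xi (fun x => (f x + g x)%R) <= L2norm P xi f + L2norm P xi g)%E.
Proof.
move=> mf mg; rewrite !L2normE; apply: minkowski_EFin; last by rewrite ler1n.
- exact: measurableT_comp.
- exact: measurableT_comp.
Qed.

Hypothesis moments : finite_moments P xi (2 * p).

(** Exponents add, so a product of two monomials of degree at most [p] is a monomial of degree at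
    most [p + p]; hence moments up to order [2 * p]. *)
Lemma integrable_monomialsM i j :
  P.-integrable setT (fun w =>
    (monomials p (xi w) i 0 * monomials p (xi w) j 0)%:E).
Proof.
have := moments (a := fun k =>
  (tnth (tnth (mindex d p) i) k + tnth (tnth (mindex d p) j) k)%N).
rewrite big_split mul2n -addnn => /(_ (leq_add (mdeg_mindex i) (mdeg_mindex j))).
by apply: eq_integrable => // w _ /=; rewrite !mxE monomialM.
Qed.

Lemma expectation_sqr_sum_monomials (v : 'cV[R]_('C(d + p, d))) :
  ('E_P[fun w => ((\sum_i v i 0 * monomials p (xi w) i 0) ^+ 2)%R])%E =
  ((v^T *m moment_matrix P xi p *m v) 0 0)%:E.
Proof.
pose b w i := monomials p (xi w) i 0.
rewrite unlock.
(* The outer index is [j] because [(v^T *m M) *m v] unfolds with the column index of M outermost. *)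
transitivity (\int[P]_w \sum_j \sum_i ((v i 0 * v j 0)%:E * (b w i * b w j)%:E))%E.
  apply: eq_integral => w _; rewrite expr2 big_distrr/= -sumEFin.
  apply: eq_bigr => j _; rewrite big_distrl/= -sumEFin; apply: eq_bigr => i _.
  by rewrite -EFinM mulrACA.
have intb i j : P.-integrable setT
    (fun w => (v i 0 * v j 0)%:E * (b w i * b w j)%:E)%E.
  by apply: integrableZl => //; exact: integrable_monomialsM.
rewrite integral_sum//; last by move=> j; exact: integrable_sum.
rewrite mxE -sumEFin; apply: eq_bigr => j _.
rewrite integral_sum// mxE big_distrl/= -sumEFin; apply: eq_bigr => i _.
have bint := integrable_monomialsM i j.
rewrite integralZl// [v^T _ _]mxE [moment_matrix _ _ _ _ _]mxE unlock.
(* Entries of [moment_matrix] go through [fine], which sends infinite values to 0; integrability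
   makes the expectation finite, so nothing is lost. *)
rewrite mulrAC [RHS]EFinM fineK//.
exact: integrable_fin_num.
Qed.

(** Parseval's identity, read off the factorization of M without computing the products of pairs of
    [psi]. *)
Lemma L2norm_expansion (L : 'M[R]_('C(d + p, d))) (c : 'cV[R]_('C(d + p, d))) :
  is_cholesky (moment_matrix P xi p) L ->
  L2norm P xi (expansion L c) = (euclid_norm c)%:E.
Proof.
move=> cholL; have Lu := is_cholesky_unitmx cholL.
rewrite /L2norm; under [X in expectation _ X]eq_fun do rewrite expansionE.
rewrite expectation_sqr_sum_monomials/= /euclid_norm.
congr (Num.sqrt _)%:E; have [_ _ ->] := cholL.
(* [L^T *m (invmx L)^T] is the transpose of [invmx L *m L], so both inner pairs cancel by
   [mulVmx]. *)
rewrite trmx_mul trmxK -!mulmxA (mulmxA L^T) -trmx_mul mulVmx// trmx1 mul1mx.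
rewrite (mulmxA (invmx L)) mulVmx// mul1mx mxE.
by apply: eq_bigr => i _; rewrite mxE expr2.
Qed.

End second_moments.

Theorem theorem4 (R : realType) (disp : measure_display)
  (Omega : measurableType disp) (P : probability Omega R)
  (d p : nat) (xi : {mfun Omega >-> d.-tuple R}) (rho : d.-tuple R -> R)
  (rho_density : joint_density P xi rho)
  (moments : finite_moments P xi (2 * p))
  (M_posdef : posdefmx (moment_matrix P xi p))
  (L : 'M[R]_('C(d + p, d))) (L_chol : is_cholesky (moment_matrix P xi p) L)
  (y : d.-tuple R -> R) (y_L2 : square_integrable P xi y)
  (c : 'cV[R]_('C(d + p, d)))
  (c_proj : L2_projection P xi (poly_space p) y (expansion L c))
  (m s : nat) (xs : 'I_m -> d.-tuple R) (cstar : 'cV[R]_('C(d + p, d)))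
  (cstar_sol :
    sparse_lsq_solution (sample_matrix L xs) (\col_k y (xs k)) s cstar) :
  (L2norm P xi (fun x => (y x - expansion L cstar x)%R)
   <= (euclid_norm (c - cstar)%R)%:E
      + L2norm P xi (fun x => (y x - expansion L c x)%R))%E.
Proof.
case: y_L2 => my _.
have -> : (fun x => y x - expansion L cstar x) =
    (fun x => expansion L (c - cstar) x + (y x - expansion L c x)).
  (* Once [y x] is cancelled, what remains is linearity in the coefficients, checked term by
     term. *)
  apply/funext => x; rewrite [X in _ = X]addrC -addrA; congr (_ + _).
  rewrite /expansion -sumrN -sumrN -big_split; apply: eq_bigr => i _.
  by rewrite /= !mxE mulrBl addKr.
(* Used from right to left, the isometry leaves a pure triangle inequality in L2. *)
rewrite -(L2norm_expansion moments _ L_chol).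
apply: ler_L2normD; first exact: measurable_expansion.
by apply: measurable_funB => //; exact: measurable_expansion.
Qed.
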